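(* For $\ell\in[0,1)$ let $F_\ell:[0,1]\to[0,1]$ be the map $$F_\ell(x)=\frac{4x(1-x)(1-\ell x)}{(1-\ell x^2)^2}.$$ Then for all $\ell,\ell'\in[0,1)$, the map $F_\ell:[0,1]\to[0,1]$ is $C^\infty$-conjugate to the map $F_{\ell'}:[0,1]\to[0,1]$.
   Context: Maps $f:A\to A$ and $g:B\to B$ are $C^\infty$-conjugate if there exists a $C^\infty$ diffeomorphism $h:A\to B$ (a bijection such that $h$ and $h^{-1}$ are both $C^\infty$) with $h\circ f=g\circ h$. On the closed interval $[0,1]$, derivatives at the endpoints are understood as one-sided derivatives. The maps $F_\ell$ are called the Katsura-Fukuda maps. *)

(* Defs.v *)
From Stdlib Require Import Reals.
Open Scope R_scope.

(* Subsets of the line are predicates, and a map A -> B between subsets is a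
   total function R -> R of which only the values on A matter. *)

Definition maps_to (A B : R -> Prop) (f : R -> R) : Prop :=
  forall x, A x -> B (f x).

(* [D_in] is the derivative relative to A: on a closed interval it is the
   two-sided derivative at interior points and the one-sided derivative at the
   endpoints.  [d n] is the n-th such derivative of f, constrained only on A.
   Meant for A without isolated points, as relative derivatives are not
   determined at an isolated point. *)
Definition smooth_on (A : R -> Prop) (f : R -> R) : Prop :=
  exists d : nat -> R -> R,
    (forall x, A x -> d O x = f x) /\
    (forall n x, A x -> D_in (d n) (d (S n)) A x).

(* [k] plays the role of the inverse of the bijection h : A -> B. *)
Definition smooth_diffeo (A B : R -> Prop) (h : R -> R) : Prop :=
  maps_to A B h /\ smooth_on A h /\
  exists k : R -> R,
    maps_to B A k /\ smooth_on B k /\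
    (forall x, A x -> k (h x) = x) /\
    (forall y, B y -> h (k y) = y).

(* That f and g are self-maps of A and B is part of the assertion. *)
Definition smoothly_conjugate
    (A : R -> Prop) (f : R -> R) (B : R -> Prop) (g : R -> R) : Prop :=
  maps_to A A f /\ maps_to B B g /\
  exists h : R -> R,
    smooth_diffeo A B h /\ (forall x, A x -> h (f x) = g (h x)).

Definition unit_interval (x : R) : Prop := 0 <= x <= 1.

Definition katsura_fukuda (l x : R) : R :=
  4 * x * (1 - x) * (1 - l * x) / (1 - l * x ^ 2) ^ 2.

(* Main.v *)
Require Import Defs.
From Stdlib Require Import Reals Lra ClassicalEpsilon.
From Coquelicot Require Import Coquelicot.
Open Scope R_scope.

(** The Katsura-Fukuda map is the duplication formula of an elliptic function:
    if x = sn^2(u, k) with k^2 = l, then F_l(x) = sn^2(2u, k).  In the angle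
    u, which runs over [0, K_l], every F_l is therefore the same tent map up to
    scale, and the conjugacy h from F_l to F_l' keeps the proportion u / K_l
    ([angle_rescaling]).  What needs proof is that h is smooth, in particular
    at the endpoints, where u behaves like a square root of the distance.

    The angle is handled without elliptic functions.  It is the primitive of
    1 / (2 sqrt (x (1-x) (1-lx))), so in any identity between angles both sides
    can be compared through their derivatives ([inner_angle_transport]).  Two
    algebraic identities then give everything about the dynamics: the Moebius
    involution [swap], which exchanges 0 and 1, acts as u -> K - u
    ([angle_swap]), and F_l acts as u -> 2u on the half of the interval where
    u <= K/2 ([angle_katsura_fukuda]).  The other half follows from
    F_l (swap x) = F_l x.

    At 0 the square of the angle is x G(x)^2, where G is a power series with
    radius of convergence at least 1, and its derivative is at least 1 on
    [0,1).  Since h satisfies (square angle for l') (h x) = c^2 (square angle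
    for l) x, it is differentiable and h' is a smooth function of x times a
    smooth function of h; hence h is smooth on [0,1) by bootstrapping
    ([smooth_on_implicit], [generated_smooth]).  On (0,1] it is smooth because
    h = swap' o h o swap, and the two pieces agree on (0,1)
    ([smooth_on_glue]).  The inverse of h is the same map with l and l'
    exchanged, so it is smooth for the same reason. *)

(** * Smooth functions on a subset of the line *)

Lemma D_in_eq_on (A : R -> Prop) (f g d : R -> R) (x : R) :
  (forall y, A y -> f y = g y) -> A x -> D_in f d A x -> D_in g d A x.
Proof.
intros Hfg Ax Hf eps Heps.
destruct (Hf eps Heps) as [del [Hdel H]].
exists del; split; [exact Hdel | intros y [[Ay Hyx] Hy]].
rewrite <- (Hfg y Ay), <- (Hfg x Ax).
apply H; split; [split|]; assumption.
Qed.

Lemma is_derive_D_in (A : R -> Prop) (f d : R -> R) (x : R) :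
  is_derive f x (d x) -> D_in f d A x.
Proof.
intros Hf; apply (D_in_imp f d no_cond A); [intros; exact I|].
apply derivable_pt_lim_D_in, is_derive_Reals; exact Hf.
Qed.

(** Coinduction for smoothness: the tower of derivatives is obtained by
    choosing a derivative inside the family again and again. *)
Lemma smooth_on_of_family (A : R -> Prop) (family : (R -> R) -> Prop) :
  (forall f, family f ->
     exists d, family d /\ forall x, A x -> D_in f d A x) ->
  forall f, family f -> smooth_on A f.
Proof.
intros step f0 Hf0.
pose (next := fun p : {f | family f} =>
  constructive_indefinite_description _ (step (proj1_sig p) (proj2_sig p))).
pose (tower := fix tower (n : nat) : {f | family f} :=
  match n with
  | O => exist _ f0 Hf0
  | S n => exist _ (proj1_sig (next (tower n)))
                   (proj1 (proj2_sig (next (tower n))))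
  end).
exists (fun n => proj1_sig (tower n)); split; [reflexivity|].
intros n; exact (proj2 (proj2_sig (next (tower n)))).
Qed.

Lemma smooth_on_derivative (A : R -> Prop) (f : R -> R) :
  smooth_on A f ->
  exists d, smooth_on A d /\ forall x, A x -> D_in f d A x.
Proof.
intros [d [d0 dS]]; exists (d 1%nat); split.
- exists (fun n => d (S n)); split; [reflexivity|].
  intros n; apply dS.
- intros x Ax; apply (D_in_eq_on A (d O)); auto.
Qed.

Lemma smooth_on_subset (A B : R -> Prop) (f : R -> R) :
  (forall x, A x -> B x) -> smooth_on B f -> smooth_on A f.
Proof.
intros AB [d [d0 dS]]; exists d; split; [auto|].
intros n x Ax; apply (D_in_imp _ _ B A); auto.
Qed.

Lemma smooth_on_ext (A : R -> Prop) (f g : R -> R) :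
  (forall x, A x -> f x = g x) -> smooth_on A f -> smooth_on A g.
Proof.
intros fg [d [d0 dS]]; exists d; split; [|exact dS].
intros x Ax; rewrite <- (fg x Ax); auto.
Qed.

Lemma smooth_on_const (A : R -> Prop) (c : R) : smooth_on A (fun _ => c).
Proof.
apply (smooth_on_of_family A (fun f => exists c, f = fun _ => c)); [|eauto].
intros f [e ->]; exists (fun _ => 0); split; [eauto|].
intros x _; apply Dconst.
Qed.

Lemma smooth_on_id (A : R -> Prop) : smooth_on A (fun x => x).
Proof.
exists (fun n => match n with O => fun x => x | S O => fun _ => 1
                 | _ => fun _ => 0 end).
split; [reflexivity|].
intros [|[|n]] x _; [apply Dx | apply Dconst | apply Dconst].
Qed.

(** This class is stable under differentiation as soon as it contains the
    derivative of [f], because (g o f)' = f' (g' o f). *)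
Inductive generated (A B : R -> Prop) (f : R -> R) : (R -> R) -> Prop :=
| generated_base g : smooth_on A g -> generated A B f g
| generated_comp g : smooth_on B g -> generated A B f (fun x => g (f x))
| generated_plus g h : generated A B f g -> generated A B f h ->
    generated A B f (fun x => g x + h x)
| generated_mult g h : generated A B f g -> generated A B f h ->
    generated A B f (fun x => g x * h x).

(** Bootstrapping in a form that covers two situations.  When [f'] is known to
    be smooth this is stability of smoothness under sums, products and
    composition; when [f'] is only known as an expression in [f] itself, as in
    a differential equation, the conclusion for [f] is new information. *)
Lemma generated_smooth (A B : R -> Prop) (f f' : R -> R) :
  maps_to A B f -> generated A B f f' ->
  (forall x, A x -> D_in f f' A x) ->
  forall g, generated A B f g -> smooth_on A g.
Proof.
intros AB Hf' Df; apply smooth_on_of_family.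
intros g Hg; induction Hg as
  [g Hg | g Hg | g h _ [g' [Hg Dg]] Kh [h' [Hh Dh]]
  | g h Kg [g' [Hg Dg]] Kh [h' [Hh Dh]]].
- destruct (smooth_on_derivative A g Hg) as [g' [Hg' Dg]].
  exists g'; split; [apply generated_base|]; assumption.
- destruct (smooth_on_derivative B g Hg) as [g' [Hg' Dg]].
  exists (fun x => f' x * g' (f x)); split.
  + apply generated_mult; [exact Hf' | apply generated_comp, Hg'].
  + intros x Ax.
    apply (D_in_imp _ _ (Dgf A B f)); [intros y Ay; split; auto|].
    apply Dcomp; auto.
- exists (fun x => g' x + h' x); split.
  + apply generated_plus; assumption.
  + intros x Ax; apply Dadd; auto.
- exists (fun x => g' x * h x + g x * h' x); split.
  + apply generated_plus; apply generated_mult; assumption.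
  + intros x Ax; apply Dmult; auto.
Qed.

Lemma smooth_on_bootstrap (A B : R -> Prop) (f f' : R -> R) :
  maps_to A B f -> generated A B f f' ->
  (forall x, A x -> D_in f f' A x) -> smooth_on A f.
Proof.
intros AB Hf' Df; apply (generated_smooth A B f f' AB Hf' Df).
apply (generated_comp A B f (fun y => y)), smooth_on_id.
Qed.

Lemma generated_id_smooth (A : R -> Prop) (g : R -> R) :
  generated A A (fun x => x) g -> smooth_on A g.
Proof.
apply (generated_smooth A A (fun x => x) (fun _ => 1)).
- intros x Ax; exact Ax.
- apply generated_base, smooth_on_const.
- intros x _; apply Dx.
Qed.

Lemma smooth_on_plus (A : R -> Prop) (f g : R -> R) :
  smooth_on A f -> smooth_on A g -> smooth_on A (fun x => f x + g x).
Proof.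
intros Hf Hg; apply generated_id_smooth.
apply generated_plus; apply generated_base; assumption.
Qed.

Lemma smooth_on_mult (A : R -> Prop) (f g : R -> R) :
  smooth_on A f -> smooth_on A g -> smooth_on A (fun x => f x * g x).
Proof.
intros Hf Hg; apply generated_id_smooth.
apply generated_mult; apply generated_base; assumption.
Qed.

Lemma smooth_on_comp (A B : R -> Prop) (f g : R -> R) :
  maps_to A B f -> smooth_on A f -> smooth_on B g ->
  smooth_on A (fun x => g (f x)).
Proof.
intros AB Hf Hg.
destruct (smooth_on_derivative A f Hf) as [f' [Hf' Df]].
apply (generated_smooth A B f f' AB); [|exact Df|].
- apply generated_base, Hf'.
- apply generated_comp, Hg.
Qed.

(** 1/x solves the differential equation f' = - f^2. *)
Lemma smooth_on_Rinv : smooth_on (fun x => x <> 0) Rinv.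
Proof.
apply (smooth_on_bootstrap _ (fun _ => True) Rinv
         (fun x => (fun y => -1 * (y * y)) (/ x))).
- intros x _; exact I.
- apply (generated_comp _ _ Rinv (fun y => -1 * (y * y))).
  apply smooth_on_mult; [apply smooth_on_const|].
  apply smooth_on_mult; apply smooth_on_id.
- intros x Hx; apply is_derive_D_in.
  auto_derive; [exact Hx | field; exact Hx].
Qed.

Lemma smooth_on_inv (A : R -> Prop) (f : R -> R) :
  (forall x, A x -> f x <> 0) -> smooth_on A f ->
  smooth_on A (fun x => / f x).
Proof.
intros Hf0 Hf.
exact (smooth_on_comp A _ f Rinv Hf0 Hf smooth_on_Rinv).
Qed.

Lemma D_in_local (A B : R -> Prop) (f d : R -> R) (x r : R) :
  0 < r -> (forall y, B y -> Rabs (y - x) < r -> A y) ->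
  D_in f d A x -> D_in f d B x.
Proof.
intros Hr BA Hf eps Heps.
destruct (Hf eps Heps) as [del [Hdel H]].
exists (Rmin r del); split; [apply Rmin_pos; assumption|].
intros y [[By Hyx] Hy].
change (Rabs (y - x) < Rmin r del) in Hy.
apply H; split; [split; [apply BA|]|]; auto.
- apply Rlt_le_trans with (1 := Hy), Rmin_l.
- apply Rlt_le_trans with (1 := Hy), Rmin_r.
Qed.

(** A neighbourhood of [x] inside [A] makes both relative derivatives ordinary
    ones, for which uniqueness is standard. *)
Lemma D_in_unique (A : R -> Prop) (f d e : R -> R) (x r : R) :
  0 < r -> (forall y, Rabs (y - x) < r -> A y) ->
  D_in f d A x -> D_in f e A x -> d x = e x.
Proof.
intros Hr HA Hd He.
assert (two_sided : forall g, D_in f g A x -> derivable_pt_lim f x (g x)).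
{ intros g Hg; apply derivable_pt_lim_D_in.
  apply (D_in_local A no_cond f g x r); auto. }
apply (uniqueness_limite f x); auto.
Qed.

(** Smoothness is local, but the towers on the two pieces are chosen
    independently: they can be pasted because derivatives are unique at the
    interior points, where the pieces overlap. *)
Lemma smooth_on_glue (a b : R) (f : R -> R) :
  a < b ->
  smooth_on (fun x => a <= x < b) f -> smooth_on (fun x => a < x <= b) f ->
  smooth_on (fun x => a <= x <= b) f.
Proof.
intros Hab [d [d0 dS]] [e [e0 eS]].
assert (agree : forall n x, a < x < b -> d n x = e n x).
{ induction n as [|n IH]; intros x Hx.
  - rewrite d0, e0 by lra; reflexivity.
  - apply (D_in_unique (fun y => a < y < b) (e n) _ _ x
             (Rmin (x - a) (b - x))).
    + apply Rmin_pos; lra.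
    + intros y Hy.
      assert (Hl := Rmin_l (x - a) (b - x)).
      assert (Hr := Rmin_r (x - a) (b - x)).
      apply Rabs_def2 in Hy; lra.
    + apply (D_in_eq_on _ (d n)); [exact IH | exact Hx |].
      apply (D_in_imp _ _ (fun y => a <= y < b)); [intros y Hy; lra|].
      apply dS; lra.
    + apply (D_in_imp _ _ (fun y => a < y <= b)); [intros y Hy; lra|].
      apply eS; lra. }
pose (g := fun n x => if Rlt_dec x b then d n x else e n x).
assert (gd : forall n x, a <= x < b -> d n x = g n x).
{ intros n x Hx; unfold g; destruct (Rlt_dec x b); [reflexivity | lra]. }
assert (ge : forall n x, a < x <= b -> e n x = g n x).
{ intros n x Hx; unfold g; destruct (Rlt_dec x b); [|reflexivity].
  symmetry; apply agree; lra. }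
exists g; split.
- intros x Hx; destruct (Rlt_dec x b).
  + rewrite <- gd, d0 by lra; reflexivity.
  + rewrite <- ge, e0 by lra; reflexivity.
- intros n x Hx; destruct (Rlt_dec x b) as [Hxb|Hxb].
  + apply (D_in_ext (d (S n))); [apply gd; lra|].
    apply (D_in_local (fun y => a <= y < b) _ _ _ _ (b - x)); [lra| |].
    * intros y Hy Hyx; apply Rabs_def2 in Hyx; lra.
    * apply (D_in_eq_on _ (d n)); [apply gd | lra | apply dS; lra].
  + apply (D_in_ext (e (S n))); [apply ge; lra|].
    apply (D_in_local (fun y => a < y <= b) _ _ _ _ (x - a)); [lra| |].
    * intros y Hy Hyx; apply Rabs_def2 in Hyx; lra.
    * apply (D_in_eq_on _ (e n)); [apply ge | lra | apply eS; lra].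
Qed.

(** An implicit function theorem for q (f x) = p x.  Expansion of [q] makes [f]
    as continuous as [p]; then the chain rule gives f' = p' / (q' o f), which
    is an expression in [f], and bootstrapping applies. *)
Lemma smooth_on_implicit (A B : R -> Prop) (f p q p' q' : R -> R) :
  maps_to A B f ->
  (forall x y, A x -> A y -> f x = f y -> x = y) ->
  (forall x, A x -> q (f x) = p x) ->
  (forall y z, B y -> B z -> Rabs (y - z) <= Rabs (q y - q z)) ->
  (forall x, A x -> D_in p p' A x) -> (forall y, B y -> D_in q q' B y) ->
  smooth_on A p' -> smooth_on B q' -> (forall y, B y -> q' y <> 0) ->
  smooth_on A f.
Proof.
intros AB inj qf expand Dp Dq Hp' Hq' q'0.
apply (smooth_on_bootstrap A B f (fun x => p' x * / q' (f x)) AB).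
- apply generated_mult; [apply generated_base, Hp'|].
  apply (generated_comp A B f (fun y => / q' y)), smooth_on_inv; assumption.
- intros x Ax.
  assert (cont : limit1_in f (D_x A x) (f x) x).
  { intros eps Heps.
    destruct (cont_deriv p p' A x (Dp x Ax) eps Heps) as [del [Hdel H]].
    exists del; split; [exact Hdel|].
    intros y Hy; apply Rle_lt_trans with (2 := H y Hy).
    destruct Hy as [[Ay _] _]; simpl; unfold Rdist.
    rewrite <- (qf x Ax), <- (qf y Ay); auto. }
  (* The slope of f is the slope of p divided by the slope of q between f x
     and f y; injectivity keeps the latter a genuine slope. *)
  assert (Hlim := limit_mul _ _ _ _ _ _
    (limit1_imp _ _ (Dgf (D_x A x) (D_x B (f x)) f) _ _
       (fun y Hy => proj1 Hy) (Dp x Ax))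
    (limit_inv _ _ _ _ (limit_comp _ _ _ _ _ _ _ cont
       (Dq (f x) (AB x Ax))) (q'0 (f x) (AB x Ax)))).
  intros eps Heps; destruct (Hlim eps Heps) as [del [Hdel H]].
  exists del; split; [exact Hdel|].
  intros y [[Ay Hyx] Hy].
  assert (Hne : f y <> f x) by (intros E; apply Hyx; auto).
  assert (Hq : q (f y) - q (f x) <> 0).
  { intros E; assert (Hle := expand (f y) (f x) (AB y Ay) (AB x Ax)).
    assert (Hpos : 0 < Rabs (f y - f x)) by (apply Rabs_pos_lt; lra).
    rewrite E, Rabs_R0 in Hle; lra. }
  replace ((f y - f x) / (y - x)) with
    ((p y - p x) / (y - x) * / ((q (f y) - q (f x)) / (f y - f x))).
  + apply H; split; [|exact Hy].
    repeat split; auto.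
  + rewrite <- (qf y Ay), <- (qf x Ax); field; lra.
Qed.

(** * Power series for the squared angle *)

Lemma CV_radius_ge_1 (a : nat -> R) (M : R) :
  (forall n, Rabs (a n) <= M) -> Rbar_le 1 (CV_radius a).
Proof.
intros Ha; apply (proj1 (CV_radius_bounded a)).
exists M; intros n; rewrite pow1, Rmult_1_r; apply Ha.
Qed.

Lemma in_unit_disk (a : nat -> R) (x : R) :
  Rbar_le 1 (CV_radius a) -> Rabs x < 1 -> Rbar_lt (Rabs x) (CV_radius a).
Proof. intros Ha Hx; apply Rbar_lt_le_trans with (2 := Ha); exact Hx. Qed.

Lemma smooth_on_PSeries (a : nat -> R) :
  Rbar_le 1 (CV_radius a) -> smooth_on (fun x => Rabs x < 1) (PSeries a).
Proof.
intros Ha.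
apply (smooth_on_of_family _
  (fun f => exists a, Rbar_le 1 (CV_radius a) /\ f = PSeries a)); [|eauto].
intros f [b [Hb ->]]; exists (PSeries (PS_derive b)); split.
- exists (PS_derive b); rewrite CV_radius_derive; auto.
- intros x Hx; apply is_derive_D_in, is_derive_PSeries, in_unit_disk;
    assumption.
Qed.

Lemma PSeries_ge_first (a : nat -> R) (x : R) :
  (forall n, 0 <= a n) -> Rbar_le 1 (CV_radius a) -> 0 <= x < 1 ->
  a O <= PSeries a x.
Proof.
intros Ha Hr Hx.
assert (Hex : ex_pseries a x).
{ apply CV_radius_inside, in_unit_disk; [exact Hr|].
  rewrite Rabs_pos_eq; lra. }
rewrite PSeries_decr_1 by exact Hex.
enough (0 <= PSeries (PS_decr_1 a) x) by nra.
rewrite <- (PSeries_const_0 x); apply Series_le.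
- intros n; rewrite Rmult_0_l; split; [lra|].
  apply Rmult_le_pos; [apply Ha | apply pow_le; lra].
- apply ex_pseries_R, (CV_radius_inside (PS_decr_1 a)).
  rewrite CV_radius_decr_1; apply in_unit_disk; [exact Hr|].
  rewrite Rabs_pos_eq; lra.
Qed.

(** Taylor coefficients of (1 - z)^(-1/2), that is C(2n,n) / 4^n. *)
Fixpoint inv_sqrt_coef (n : nat) : R :=
  match n with
  | O => 1
  | S k => inv_sqrt_coef k * ((2 * INR k + 1) / (2 * INR k + 2))
  end.

Definition inv_sqrt_series (z : R) : R := PSeries inv_sqrt_coef z.

Lemma inv_sqrt_coef_bounds (n : nat) : 0 <= inv_sqrt_coef n <= 1.
Proof.
induction n as [|n IH]; simpl; [lra|].
assert (Hn := pos_INR n).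
assert (0 <= (2 * INR n + 1) / (2 * INR n + 2) <= 1).
{ split; [apply Rdiv_le_0_compat; lra | apply Rle_div_l; lra]. }
nra.
Qed.

Lemma inv_sqrt_radius : Rbar_le 1 (CV_radius inv_sqrt_coef).
Proof.
apply (CV_radius_ge_1 _ 1); intros n.
destruct (inv_sqrt_coef_bounds n); rewrite Rabs_pos_eq; assumption.
Qed.

Lemma inv_sqrt_series_ode (z : R) :
  Rabs z < 1 ->
  2 * (1 - z) * PSeries (PS_derive inv_sqrt_coef) z = inv_sqrt_series z.
Proof.
intros Hz; unfold inv_sqrt_series.
set (a := inv_sqrt_coef).
assert (Hex : ex_pseries (PS_derive a) z).
{ apply ex_pseries_derive, in_unit_disk; [apply inv_sqrt_radius | exact Hz]. }
rewrite (PSeries_ext a (PS_plus (PS_scal 2 (PS_derive a))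
                         (PS_scal (-2) (PS_incr_1 (PS_derive a))))).
- rewrite PSeries_plus, !PSeries_scal, PSeries_incr_1; [ring| |].
  + apply ex_pseries_scal; [apply Rmult_comm | exact Hex].
  + apply ex_pseries_scal; [apply Rmult_comm | apply ex_pseries_incr_1, Hex].
- intros [|n]; unfold PS_plus, PS_scal, PS_incr_1, PS_derive, plus, scal,
    zero; simpl; unfold mult; simpl; [field|].
  fold (INR (S n)); fold (a n).
  change (match n with O => 1 | S _ => INR n + 1 end) with (INR (S n)).
  rewrite !S_INR; assert (Hn := pos_INR n); field; lra.
Qed.

(** By the differential equation 2 (1 - z) A' = A, the function A^2 (1 - z) has
    zero derivative, and its value at 0 is 1. *)
Lemma inv_sqrt_series_square (z : R) :
  Rabs z < 1 -> inv_sqrt_series z ^ 2 * (1 - z) = 1.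
Proof.
intros Hz.
pose (f := fun z => inv_sqrt_series z ^ 2 * (1 - z)).
assert (Hf : forall t, Rabs t < 1 -> is_derive f t 0).
{ intros t Ht.
  assert (Hd : is_derive inv_sqrt_series t
                 (PSeries (PS_derive inv_sqrt_coef) t)).
  { apply is_derive_PSeries, in_unit_disk; [apply inv_sqrt_radius|exact Ht]. }
  unfold f; auto_derive.
  - eexists; exact Hd.
  - rewrite (is_derive_unique (fun x : R => inv_sqrt_series x) _ _ Hd).
    rewrite <- (inv_sqrt_series_ode t Ht); ring. }
change (f z = 1).
replace 1 with (f 0).
- apply Rabs_def2 in Hz.
  destruct (Rtotal_order z 0) as [Hlt|[->|Hgt]]; [|reflexivity|].
  + apply (eq_is_derive f); [|exact Hlt].
    intros t Ht; apply Hf, Rabs_def1; lra.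
  + symmetry; apply (eq_is_derive f); [|exact Hgt].
    intros t Ht; apply Hf, Rabs_def1; lra.
- unfold f, inv_sqrt_series; rewrite PSeries_0; simpl; ring.
Qed.

Lemma inv_sqrt_series_ge_1 (z : R) : 0 <= z < 1 -> 1 <= inv_sqrt_series z.
Proof.
intros Hz.
apply (PSeries_ge_first inv_sqrt_coef); [|apply inv_sqrt_radius | exact Hz].
intros n; apply inv_sqrt_coef_bounds.
Qed.

(** ((1 - x) (1 - l x))^(-1/2): twice the derivative of the angle, without
    its factor 1 / sqrt x. *)
Definition density (l x : R) : R := inv_sqrt_series x * inv_sqrt_series (l * x).

Definition density_coef (l : R) : nat -> R :=
  PS_mult inv_sqrt_coef (fun n => inv_sqrt_coef n * l ^ n).

(** Integrating the density against dx / (2 sqrt x) term by term turns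
    p_n x^n into sqrt x * p_n x^n / (2n+1): the angle is sqrt x times the series
    with these coefficients. *)
Definition angle_coef (l : R) (n : nat) : R :=
  density_coef l n / (2 * INR n + 1).

Definition reduced_angle (l x : R) : R := PSeries (angle_coef l) x.

Definition square_angle (l x : R) : R := x * reduced_angle l x ^ 2.

Section Modulus.
Variable l : R.
Hypothesis hl : 0 <= l < 1.

Lemma scaled_coef_bounds (n : nat) : 0 <= inv_sqrt_coef n * l ^ n <= 1.
Proof.
assert (Ha := inv_sqrt_coef_bounds n).
assert (0 <= l ^ n) by (apply pow_le; lra).
assert (l ^ n <= 1) by (rewrite <- (pow1 n); apply pow_incr; lra).
nra.
Qed.

(** This crude bound is enough: dividing by 2n+1 gives bounded coefficients,
    hence radius of convergence at least 1 for the reduced angle. *)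
Lemma density_coef_bounds (n : nat) : 0 <= density_coef l n <= INR n + 1.
Proof.
unfold density_coef, PS_mult; split.
- apply cond_pos_sum; intros k; apply Rmult_le_pos;
    [apply inv_sqrt_coef_bounds | apply scaled_coef_bounds].
- rewrite <- S_INR, <- (Rmult_1_l (INR (S n))), <- sum_cte.
  apply sum_Rle; intros k _.
  assert (H1 := inv_sqrt_coef_bounds k).
  assert (H2 := scaled_coef_bounds (n - k)); nra.
Qed.

Lemma angle_coef_bounds (n : nat) : 0 <= angle_coef l n <= 1.
Proof.
assert (Hp := density_coef_bounds n); assert (Hn := pos_INR n).
unfold angle_coef; split.
- apply Rdiv_le_0_compat; lra.
- apply Rle_div_l; lra.
Qed.

Lemma angle_radius : Rbar_le 1 (CV_radius (angle_coef l)).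
Proof.
apply (CV_radius_ge_1 _ 1); intros n.
destruct (angle_coef_bounds n); rewrite Rabs_pos_eq; assumption.
Qed.

Lemma Rabs_scaled (x : R) : Rabs x < 1 -> Rabs (l * x) < 1.
Proof.
intros Hx; rewrite Rabs_mult, (Rabs_pos_eq l) by lra.
assert (H0 := Rabs_pos x); nra.
Qed.

Lemma density_PSeries (x : R) :
  Rabs x < 1 -> density l x = PSeries (density_coef l) x.
Proof.
intros Hx; unfold density, density_coef.
rewrite PSeries_mult.
- f_equal; apply Series_ext; intros n; rewrite Rpow_mult_distr; ring.
- apply in_unit_disk; [apply inv_sqrt_radius | exact Hx].
- apply in_unit_disk; [|exact Hx].
  apply (CV_radius_ge_1 _ 1); intros n.
  destruct (scaled_coef_bounds n); rewrite Rabs_pos_eq; assumption.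
Qed.

(** Coefficientwise this is (2n+1) g_n = p_n. *)
Lemma reduced_angle_ode (x : R) :
  Rabs x < 1 ->
  reduced_angle l x + 2 * (x * PSeries (PS_derive (angle_coef l)) x)
  = density l x.
Proof.
intros Hx; rewrite density_PSeries by exact Hx.
unfold reduced_angle; set (g := angle_coef l).
assert (Hg : ex_pseries g x).
{ apply CV_radius_inside, in_unit_disk; [apply angle_radius | exact Hx]. }
assert (Hex : ex_pseries (PS_derive g) x).
{ apply ex_pseries_derive, in_unit_disk; [apply angle_radius | exact Hx]. }
rewrite <- (PSeries_incr_1 (PS_derive g)), <- (PSeries_scal 2), <- PSeries_plus.
- apply PSeries_ext; intros n.
  assert (Hn := pos_INR n).
  transitivity (g n + 2 * (INR n * g n)).
  + destruct n as [|n]; [|reflexivity].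
    unfold PS_plus, PS_scal, PS_incr_1, plus, scal, zero; simpl.
    unfold mult; simpl; ring.
  + unfold g, angle_coef; field; lra.
- exact Hg.
- apply ex_pseries_scal; [apply Rmult_comm | apply ex_pseries_incr_1, Hex].
Qed.

Lemma is_derive_reduced_angle (x : R) : Rabs x < 1 ->
  is_derive (reduced_angle l) x (PSeries (PS_derive (angle_coef l)) x).
Proof.
intros Hx; apply is_derive_PSeries, in_unit_disk; [apply angle_radius|exact Hx].
Qed.

Lemma is_derive_square_angle (x : R) :
  Rabs x < 1 ->
  is_derive (square_angle l) x (reduced_angle l x * density l x).
Proof.
intros Hx; assert (Hd := is_derive_reduced_angle x Hx).
unfold square_angle; auto_derive.
- eexists; exact Hd.
- rewrite (is_derive_unique (fun x : R => reduced_angle l x) _ _ Hd).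
  rewrite <- reduced_angle_ode by exact Hx; ring.
Qed.

Lemma density_ge_1 (x : R) : 0 <= x < 1 -> 1 <= density l x.
Proof.
intros Hx; unfold density.
assert (H1 := inv_sqrt_series_ge_1 x Hx).
assert (H2 : 1 <= inv_sqrt_series (l * x))
  by (apply inv_sqrt_series_ge_1; nra).
nra.
Qed.

Lemma reduced_angle_ge_1 (x : R) : 0 <= x < 1 -> 1 <= reduced_angle l x.
Proof.
intros Hx; replace 1 with (angle_coef l 0).
- apply PSeries_ge_first; [|apply angle_radius | exact Hx].
  intros n; apply angle_coef_bounds.
- unfold angle_coef, density_coef, PS_mult; simpl; field.
Qed.

Lemma density_square (x : R) :
  Rabs x < 1 -> density l x ^ 2 * ((1 - x) * (1 - l * x)) = 1.
Proof.
intros Hx; unfold density.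
transitivity ((inv_sqrt_series x ^ 2 * (1 - x))
              * (inv_sqrt_series (l * x) ^ 2 * (1 - l * x))); [ring|].
rewrite !inv_sqrt_series_square; [ring | apply Rabs_scaled, Hx | exact Hx].
Qed.

Lemma smooth_on_square_angle_derivative :
  smooth_on (fun x => 0 <= x < 1) (fun x => reduced_angle l x * density l x).
Proof.
apply (smooth_on_subset _ (fun x => Rabs x < 1)).
{ intros x Hx; rewrite Rabs_pos_eq; lra. }
apply smooth_on_mult; [apply smooth_on_PSeries, angle_radius|].
apply smooth_on_mult; [apply smooth_on_PSeries, inv_sqrt_radius|].
apply (smooth_on_comp _ (fun x => Rabs x < 1) (fun x => l * x)).
- intros x; apply Rabs_scaled.
- apply smooth_on_mult; [apply smooth_on_const | apply smooth_on_id].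
- apply smooth_on_PSeries, inv_sqrt_radius.
Qed.

(** The derivative is the product of two series that are at least 1. *)
Lemma square_angle_increase (x y : R) :
  0 <= x <= y -> y < 1 -> y - x <= square_angle l y - square_angle l x.
Proof.
intros Hx Hy.
destruct (MVT_gen (square_angle l) x y
            (fun t => reduced_angle l t * density l t)) as [c [Hc E]].
- intros t Ht; rewrite Rmin_left, Rmax_right in Ht by lra.
  apply is_derive_square_angle; rewrite Rabs_pos_eq; lra.
- intros t Ht; rewrite Rmin_left, Rmax_right in Ht by lra.
  apply derivable_continuous_pt.
  eexists; apply is_derive_Reals, is_derive_square_angle.
  rewrite Rabs_pos_eq; lra.
- rewrite Rmin_left, Rmax_right in Hc by lra; rewrite E.
  assert (HG : 1 <= reduced_angle l c) by (apply reduced_angle_ge_1; lra).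
  assert (HR : 1 <= density l c) by (apply density_ge_1; lra).
  assert (1 <= reduced_angle l c * density l c) by nra.
  nra.
Qed.

Lemma square_angle_expanding (x y : R) :
  0 <= x < 1 -> 0 <= y < 1 ->
  Rabs (x - y) <= Rabs (square_angle l x - square_angle l y).
Proof.
intros Hx Hy; destruct (Rle_dec x y) as [Hxy|Hxy].
- assert (H := square_angle_increase x y).
  rewrite (Rabs_left1 (x - y)), Rabs_left1; lra.
- assert (H := square_angle_increase y x).
  rewrite (Rabs_pos_eq (x - y)), Rabs_pos_eq; lra.
Qed.
End Modulus.

(** * The angle coordinate and the map in it *)

Definition cubic (l x : R) : R := x * (1 - x) * (1 - l * x).
(** The angle u with x = sn^2(u, k), k^2 = l, for x < 1.  The point
    x = 1 lies on the boundary of the disk of convergence of the series, so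
    its angle is supplied separately. *)
Definition inner_angle (l x : R) : R := sqrt (square_angle l x).
(** Translation of sn^2 by a quarter period: if x = sn^2(u) then
    swap l x = sn^2(K - u). *)
Definition swap (l x : R) : R := (1 - x) / (1 - l * x).
(** The complete elliptic integral K.  As u(x) + u(swap x) does not depend on
    x, it can be read off at any interior point. *)
Definition complete_angle (l : R) : R :=
  inner_angle l (/ 2) + inner_angle l (swap l (/ 2)).
Definition angle (l x : R) : R :=
  if Rlt_dec x 1 then inner_angle l x else complete_angle l.

Section Modulus.
Variable l : R.
Hypothesis hl : 0 <= l < 1.

Lemma square_angle_0 : square_angle l 0 = 0.
Proof. unfold square_angle; ring. Qed.

Lemma square_angle_nonneg (x : R) : 0 <= x -> 0 <= square_angle l x.
Proof. intros Hx; apply Rmult_le_pos; [exact Hx | apply pow2_ge_0]. Qed.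

Lemma inner_angle_increasing (x y : R) :
  0 <= x < y -> y < 1 -> inner_angle l x < inner_angle l y.
Proof.
intros Hx Hy; apply sqrt_lt_1_alt; split.
- apply square_angle_nonneg; lra.
- assert (H := square_angle_increase l hl x y); lra.
Qed.

Lemma inner_angle_0 : inner_angle l 0 = 0.
Proof. unfold inner_angle; rewrite square_angle_0; apply sqrt_0. Qed.

Lemma inner_angle_pos (x : R) : 0 < x < 1 -> 0 < inner_angle l x.
Proof.
intros Hx; rewrite <- inner_angle_0; apply inner_angle_increasing; lra.
Qed.

Lemma cubic_pos (x : R) : 0 < x < 1 -> 0 < cubic l x.
Proof.
intros Hx; unfold cubic; repeat apply Rmult_lt_0_compat; nra.
Qed.

Lemma is_derive_inner_angle (x : R) :
  0 < x < 1 -> is_derive (inner_angle l) x (/ (2 * sqrt (cubic l x))).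
Proof.
intros Hx.
assert (Habs : Rabs x < 1) by (rewrite Rabs_pos_eq; lra).
assert (HG := reduced_angle_ge_1 l hl x ltac:(lra)).
assert (HR := density_ge_1 l hl x ltac:(lra)).
assert (HP := cubic_pos x Hx).
assert (HQ : 0 < square_angle l x)
  by (unfold square_angle; apply Rmult_lt_0_compat; nra).
assert (Hu := sqrt_lt_R0 _ HQ).
assert (Hv := sqrt_lt_R0 _ HP).
assert (Hd := is_derive_square_angle l hl x Habs).
unfold inner_angle; auto_derive.
- split; [eexists; exact Hd | split; [exact HQ | exact I]].
- rewrite (is_derive_unique (fun x : R => square_angle l x) _ _ Hd).
  assert (E : sqrt (square_angle l x)
              = reduced_angle l x * density l x * sqrt (cubic l x)).
  { apply Rsqr_inj; [lra | apply Rmult_le_pos; nra |].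
    rewrite Rsqr_sqrt by lra.
    rewrite Rsqr_mult, Rsqr_sqrt by lra.
    unfold square_angle, cubic, Rsqr.
    transitivity (x * reduced_angle l x ^ 2
      * (density l x ^ 2 * ((1 - x) * (1 - l * x)))); [|ring].
    rewrite density_square by assumption; ring. }
  rewrite E; field; repeat split; lra.
Qed.

(** Since u' = 1 / (2 sqrt P) with P the cubic, the hypothesis on [phi] says
    exactly that u o phi and c u have the same derivative. *)
Lemma inner_angle_transport (phi dphi : R -> R) (c x y : R) :
  x <= y ->
  (forall t, x <= t <= y ->
     0 < t < 1 /\ 0 < phi t < 1 /\ is_derive phi t (dphi t) /\
     dphi t * sqrt (cubic l t) = c * sqrt (cubic l (phi t))) ->
  inner_angle l (phi x) - c * inner_angle l x
  = inner_angle l (phi y) - c * inner_angle l y.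
Proof.
intros Hxy H; destruct Hxy as [Hxy|<-]; [|reflexivity].
apply (eq_is_derive (fun t => inner_angle l (phi t) - c * inner_angle l t));
  [|exact Hxy].
intros t Ht; destruct (H t Ht) as (Ht1 & Hp1 & Hd & E).
assert (Da := is_derive_inner_angle t Ht1).
assert (Db := is_derive_inner_angle (phi t) Hp1).
assert (Sa := sqrt_lt_R0 _ (cubic_pos t Ht1)).
assert (Sb := sqrt_lt_R0 _ (cubic_pos (phi t) Hp1)).
auto_derive.
- repeat split; eexists; eassumption.
- rewrite (is_derive_unique (fun x : R => phi x) _ _ Hd).
  rewrite (is_derive_unique (fun x : R => inner_angle l x) _ _ Da).
  rewrite (is_derive_unique (fun x : R => inner_angle l x) _ _ Db).
  replace (dphi t) with
    (c * sqrt (cubic l (phi t)) / sqrt (cubic l t))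
    by (rewrite <- E; field; lra).
  unfold zero; simpl; field; lra.
Qed.

Lemma swap_denominator (x : R) : x <= 1 -> 0 < 1 - l * x.
Proof. intros Hx; nra. Qed.

Lemma swap_range (x : R) : 0 <= x <= 1 -> 0 <= swap l x <= 1.
Proof.
intros Hx; assert (Hd := swap_denominator x ltac:(lra)).
unfold swap; split.
- apply Rdiv_le_0_compat; lra.
- apply Rle_div_l; nra.
Qed.

Lemma swap_lt_1 (x : R) : 0 < x <= 1 -> swap l x < 1.
Proof.
intros Hx; assert (Hd := swap_denominator x ltac:(lra)).
unfold swap; apply Rlt_div_l; nra.
Qed.

Lemma swap_pos (x : R) : 0 <= x < 1 -> 0 < swap l x.
Proof.
intros Hx; assert (Hd := swap_denominator x ltac:(lra)).
apply Rdiv_lt_0_compat; lra.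
Qed.

Lemma swap_0 : swap l 0 = 1.
Proof. unfold swap; field; lra. Qed.

Lemma swap_1 : swap l 1 = 0.
Proof. unfold swap; field; lra. Qed.

Lemma swap_involutive (x : R) : x <= 1 -> swap l (swap l x) = x.
Proof.
intros Hx; assert (Hd := swap_denominator x Hx).
unfold swap; field; split; [lra|].
replace (1 - l * x - l * (1 - x)) with (1 - l) by ring; lra.
Qed.

(** Here P (swap x) = ((1-l) / (1-lx)^2)^2 P x, and swap' is minus the square
    root of that factor, so the transport constant is -1. *)
Lemma inner_angle_swap (x : R) :
  0 < x < 1 -> inner_angle l (swap l x) = complete_angle l - inner_angle l x.
Proof.
assert (step : forall x y, 0 < x <= y -> y < 1 ->
  inner_angle l (swap l x) - -1 * inner_angle l x
  = inner_angle l (swap l y) - -1 * inner_angle l y).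
{ clear x; intros x y Hx Hy.
  apply (inner_angle_transport (swap l)
           (fun t => - (1 - l) / (1 - l * t) ^ 2)); [lra|].
  intros t Ht; assert (Hd := swap_denominator t ltac:(lra)).
  split; [lra|]; split; [split|split].
  - apply swap_pos; lra.
  - apply swap_lt_1; lra.
  - unfold swap; auto_derive; [lra | field; lra].
  - replace (cubic l (swap l t))
      with (Rsqr ((1 - l) / (1 - l * t) ^ 2) * cubic l t)
      by (unfold cubic, swap, Rsqr; field; lra).
    rewrite sqrt_mult_alt by apply Rle_0_sqr.
    rewrite sqrt_Rsqr; [field; lra|].
    apply Rdiv_le_0_compat; [lra | apply pow_lt, Hd]. }
intros Hx; unfold complete_angle.
destruct (Rle_dec x (/ 2)) as [H|H].
- assert (E := step x (/ 2)); lra.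
- assert (E := step (/ 2) x); lra.
Qed.

Lemma angle_inner (x : R) : x < 1 -> angle l x = inner_angle l x.
Proof. intros Hx; unfold angle; destruct (Rlt_dec x 1); [easy | lra]. Qed.

Lemma angle_1 : angle l 1 = complete_angle l.
Proof. unfold angle; destruct (Rlt_dec 1 1); [lra | reflexivity]. Qed.

Lemma angle_0 : angle l 0 = 0.
Proof. rewrite angle_inner by lra; apply inner_angle_0. Qed.

Lemma angle_swap (x : R) :
  0 <= x <= 1 -> angle l (swap l x) = complete_angle l - angle l x.
Proof.
intros Hx.
destruct (Req_dec x 0) as [->|H0]; [rewrite swap_0, angle_0, angle_1; ring|].
destruct (Req_dec x 1) as [->|H1]; [rewrite swap_1, angle_0, angle_1; ring|].
rewrite !angle_inner; [apply inner_angle_swap | | apply swap_lt_1]; lra.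
Qed.

Lemma complete_angle_pos : 0 < complete_angle l.
Proof.
assert (H1 := inner_angle_pos (/ 2) ltac:(lra)).
assert (H2 := inner_angle_swap (/ 2) ltac:(lra)).
assert (H3 := inner_angle_pos (swap l (/ 2))
  (conj (swap_pos (/ 2) ltac:(lra)) (swap_lt_1 (/ 2) ltac:(lra)))).
lra.
Qed.

Lemma angle_increasing (x y : R) :
  0 <= x < y -> y <= 1 -> angle l x < angle l y.
Proof.
intros Hx Hy; rewrite (angle_inner x) by lra.
destruct Hy as [Hy| ->].
- rewrite angle_inner by exact Hy; apply inner_angle_increasing; assumption.
- rewrite angle_1; destruct (Req_dec x 0) as [->|H0].
  + rewrite inner_angle_0; apply complete_angle_pos.
  + assert (H1 := inner_angle_swap x ltac:(lra)).
    assert (H2 := inner_angle_pos (swap l x)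
      (conj (swap_pos x ltac:(lra)) (swap_lt_1 x ltac:(lra)))).
    lra.
Qed.

Lemma angle_le_inv (x y : R) :
  0 <= x <= 1 -> 0 <= y <= 1 -> angle l x <= angle l y -> x <= y.
Proof.
intros Hx Hy H; apply Rnot_lt_le; intros Hlt.
assert (H' := angle_increasing y x); lra.
Qed.

Lemma angle_injective (x y : R) :
  0 <= x <= 1 -> 0 <= y <= 1 -> angle l x = angle l y -> x = y.
Proof. intros Hx Hy E; apply Rle_antisym; apply angle_le_inv; lra. Qed.

Lemma angle_bounds (x : R) :
  0 <= x <= 1 -> 0 <= angle l x <= complete_angle l.
Proof.
intros Hx; assert (HK := complete_angle_pos).
assert (A := angle_increasing 0 x); assert (B := angle_increasing x 1).
rewrite angle_0 in A; rewrite angle_1 in B.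
destruct (Req_dec x 0) as [->|H0]; [rewrite angle_0; lra|].
destruct (Req_dec x 1) as [->|H1]; [rewrite angle_1|]; lra.
Qed.

Lemma continuity_square_angle (x : R) :
  0 <= x < 1 -> continuity_pt (square_angle l) x.
Proof.
intros Hx; apply derivable_continuous_pt.
eexists; apply is_derive_Reals, is_derive_square_angle; [exact hl|].
rewrite Rabs_pos_eq; lra.
Qed.

(** Controls the angle near 0, where it is continuous but has no
    derivative. *)
Lemma inner_angle_small (eps : R) :
  0 < eps -> exists del, 0 < del <= 1 /\
    forall x, 0 <= x < del -> 0 <= inner_angle l x < eps.
Proof.
intros Heps.
destruct (continuity_square_angle 0 ltac:(lra) (eps * eps) ltac:(nra))
  as [del [Hdel H]].
exists (Rmin del 1); split.
- split; [apply Rmin_pos; lra | apply Rmin_r].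
- intros x Hx; split; [apply sqrt_pos|].
  assert (Hl := Rmin_l del 1).
  destruct (Req_dec x 0) as [->|H0]; [rewrite inner_angle_0; exact Heps|].
  rewrite <- (sqrt_square eps) by lra.
  apply sqrt_lt_1_alt; split; [apply square_angle_nonneg; lra|].
  assert (Hx' : Rabs (square_angle l x - square_angle l 0) < eps * eps).
  { apply (H x); split; [split; [exact I | auto]|].
    simpl; unfold Rdist; rewrite Rabs_pos_eq; lra. }
  rewrite square_angle_0 in Hx'; apply Rabs_def2 in Hx'; lra.
Qed.

(** By the intermediate value theorem on [0, y], where y is the swap of a point
    close to 0, so that its angle is close to K. *)
Lemma angle_surjective (v : R) :
  0 <= v <= complete_angle l -> exists x, 0 <= x <= 1 /\ angle l x = v.
Proof.
intros Hv.
destruct (Req_dec v (complete_angle l)) as [->|HK].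
{ exists 1; split; [lra | apply angle_1]. }
destruct (Req_dec v 0) as [->|H0].
{ exists 0; split; [lra | apply angle_0]. }
destruct (inner_angle_small (complete_angle l - v) ltac:(lra))
  as [del [Hdel Hsmall]].
assert (Hd2 := Hsmall (del / 2) ltac:(lra)).
pose (y := swap l (del / 2)).
assert (Hy : 0 < y < 1).
{ split; [apply swap_pos | apply swap_lt_1]; lra. }
assert (Hvy : v < inner_angle l y).
{ unfold y; rewrite inner_angle_swap; lra. }
destruct (Ranalysis5.IVT_interv (fun x => square_angle l x - v * v) 0 y)
  as [x [Hx E]].
- intros t Ht; apply continuity_pt_minus.
  + apply continuity_square_angle; lra.
  + apply continuity_pt_const; intros a b; reflexivity.
- lra.
- rewrite square_angle_0; nra.
- assert (Hsq := sqrt_sqrt (square_angle l y)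
                   (square_angle_nonneg y ltac:(lra))).
  fold (inner_angle l y) in Hsq; nra.
- exists x; split; [lra|].
  rewrite angle_inner by lra; unfold inner_angle.
  replace (square_angle l x) with (v * v) by lra.
  apply sqrt_square; lra.
Qed.

Lemma katsura_fukuda_denominator (x : R) : 0 <= x <= 1 -> 0 < 1 - l * x ^ 2.
Proof. intros Hx; assert (0 <= x ^ 2 <= 1) by (split; nra); nra. Qed.

(** The numerator on the right vanishes at the critical point, the fixed point
    of [swap], and is positive to the left of it. *)
Lemma one_minus_katsura_fukuda (x : R) :
  0 <= x <= 1 ->
  1 - katsura_fukuda l x = Rsqr ((1 - 2 * x + l * x ^ 2) / (1 - l * x ^ 2)).
Proof.
intros Hx; assert (Hd := katsura_fukuda_denominator x Hx).
unfold katsura_fukuda, Rsqr; field; lra.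
Qed.

Lemma katsura_fukuda_range (x : R) :
  0 <= x <= 1 -> 0 <= katsura_fukuda l x <= 1.
Proof.
intros Hx; assert (Hd := katsura_fukuda_denominator x Hx); split.
- apply Rdiv_le_0_compat; [|apply pow_lt, Hd].
  repeat apply Rmult_le_pos; nra.
- assert (H := Rle_0_sqr ((1 - 2 * x + l * x ^ 2) / (1 - l * x ^ 2))).
  rewrite <- one_minus_katsura_fukuda in H by exact Hx; lra.
Qed.

Lemma katsura_fukuda_swap (x : R) :
  0 <= x <= 1 -> katsura_fukuda l (swap l x) = katsura_fukuda l x.
Proof.
intros Hx; assert (H1 := swap_denominator x ltac:(lra)).
assert (H2 := katsura_fukuda_denominator x Hx).
unfold katsura_fukuda, swap; field; repeat split; try lra.
replace ((1 - l * x) ^ 2 - l * (1 - x) ^ 2) with ((1 - l) * (1 - l * x ^ 2))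
  by ring.
nra.
Qed.

Lemma le_swap (x : R) :
  0 <= x <= 1 -> (x <= swap l x <-> 0 <= 1 - 2 * x + l * x ^ 2).
Proof.
intros Hx; assert (H1 := swap_denominator x ltac:(lra)).
replace (1 - 2 * x + l * x ^ 2) with ((1 - x) - x * (1 - l * x)) by ring.
split; intros H.
- apply Rle_div_r in H; lra.
- apply Rle_div_r; lra.
Qed.

(** F' sqrt P = 2 sqrt (P o F) to the left of the critical point, so
    u o F - 2u is constant there; letting x tend to 0 shows that the constant
    is 0. *)
Lemma inner_angle_katsura_fukuda (x : R) :
  0 < x < 1 -> 0 < 1 - 2 * x + l * x ^ 2 ->
  inner_angle l (katsura_fukuda l x) = 2 * inner_angle l x.
Proof.
intros Hx Hq.
assert (range : forall t, 0 < t <= x -> 0 < katsura_fukuda l t < 1).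
{ intros t Ht; assert (Hd := katsura_fukuda_denominator t ltac:(lra)); split.
  - apply Rdiv_lt_0_compat; [|apply pow_lt, Hd].
    repeat apply Rmult_lt_0_compat; nra.
  - assert (H : 0 < (1 - 2 * t + l * t ^ 2) / (1 - l * t ^ 2)).
    { apply Rdiv_lt_0_compat; [|exact Hd].
      assert (0 <= (x - t) * (2 - l * (x + t))) by (apply Rmult_le_pos; nra).
      nra. }
    assert (H' := Rsqr_pos_lt _ (Rgt_not_eq _ _ H)).
    rewrite <- one_minus_katsura_fukuda in H' by lra; lra. }
assert (step : forall t, 0 < t <= x ->
  inner_angle l (katsura_fukuda l t) - 2 * inner_angle l t
  = inner_angle l (katsura_fukuda l x) - 2 * inner_angle l x).
{ intros t Ht.
  apply (inner_angle_transport (katsura_fukuda l)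
    (fun s => 4 * (1 - 2 * s + l * s ^ 2) * (1 - 2 * l * s + l * s ^ 2)
              / (1 - l * s ^ 2) ^ 3)); [lra|].
  intros s Hs; assert (Hd := katsura_fukuda_denominator s ltac:(lra)).
  split; [lra|]; split; [apply range; lra|]; split.
  - unfold katsura_fukuda; auto_derive.
    + apply Rmult_integral_contrapositive; split; lra || nra.
    + field; lra.
  - replace (cubic l (katsura_fukuda l s)) with
      (Rsqr (2 * (1 - 2 * s + l * s ^ 2) * (1 - 2 * l * s + l * s ^ 2)
             / (1 - l * s ^ 2) ^ 3) * cubic l s)
      by (unfold cubic, katsura_fukuda, Rsqr; field; lra).
    rewrite sqrt_mult_alt by apply Rle_0_sqr.
    rewrite sqrt_Rsqr; [field; lra|].
    apply Rdiv_le_0_compat; [|apply pow_lt, Hd].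
    assert (0 <= (x - s) * (2 - l * (x + s))) by (apply Rmult_le_pos; nra).
    assert (0 <= 1 - 2 * l * s + l * s ^ 2).
    { replace (1 - 2 * l * s + l * s ^ 2)
        with ((1 - l * s) ^ 2 + l * (1 - l) * s ^ 2) by ring.
      assert (0 <= l * (1 - l)) by nra.
      assert (H1 := pow2_ge_0 (1 - l * s)); assert (H2 := pow2_ge_0 s); nra. }
    repeat apply Rmult_le_pos; nra. }
enough (small : forall eps, 0 < eps ->
  Rabs (inner_angle l (katsura_fukuda l x) - 2 * inner_angle l x) <= eps).
{ apply Rminus_diag_uniq; apply Rabs_eq_0.
  apply Rle_antisym; [apply le_epsilon | apply Rabs_pos].
  intros eps Heps; rewrite Rplus_0_l; auto. }
intros eps Heps.
destruct (inner_angle_small (eps / 3) ltac:(lra)) as [del [Hdel Hsmall]].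
assert (Hl2 : 0 < (1 - l) ^ 2 <= 1) by (split; [apply pow_lt; lra | nra]).
assert (Hdl : 0 < del * (1 - l) ^ 2 <= del)
  by (split; [apply Rmult_lt_0_compat; lra | nra]).
(* F t <= 4 t / (1-l)^2, so this t puts both t and F t below del. *)
pose (t := Rmin x (del * (1 - l) ^ 2 / 8)).
assert (Ht : 0 < t <= x).
{ split; [apply Rmin_pos; lra | apply Rmin_l]. }
assert (Ht' : t <= del * (1 - l) ^ 2 / 8) by apply Rmin_r.
assert (HF : katsura_fukuda l t < del).
{ assert (Hd := katsura_fukuda_denominator t ltac:(lra)).
  apply Rlt_div_l; [apply pow_lt, Hd|].
  assert (0 <= t ^ 2 <= 1) by (split; nra).
  assert (1 - l <= 1 - l * t ^ 2) by nra.
  assert ((1 - l) ^ 2 <= (1 - l * t ^ 2) ^ 2) by (apply pow_incr; lra).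
  assert (4 * t * (1 - t) * (1 - l * t) <= 4 * t).
  { assert (0 <= (1 - t) * (1 - l * t) <= 1) by (split; nra). nra. }
  assert (del * (1 - l) ^ 2 <= del * (1 - l * t ^ 2) ^ 2)
    by (apply Rmult_le_compat_l; lra).
  lra. }
rewrite <- (step t Ht).
assert (H1 := Hsmall t ltac:(lra)).
assert (H2 := range t Ht).
assert (H3 := Hsmall (katsura_fukuda l t) ltac:(lra)).
apply Rabs_le; lra.
Qed.

(** The condition x <= swap l x means u <= K/2.  Equality is the critical
    point, where u = K/2 and F x = 1. *)
Lemma angle_katsura_fukuda (x : R) :
  0 <= x <= 1 -> x <= swap l x ->
  angle l (katsura_fukuda l x) = 2 * angle l x.
Proof.
intros Hx Hq; apply le_swap in Hq; [|exact Hx].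
destruct (Req_dec x 0) as [->|H0].
{ replace (katsura_fukuda l 0) with 0
    by (unfold katsura_fukuda; field; lra).
  rewrite angle_0; ring. }
assert (H1 : x < 1) by (destruct (Req_dec x 1) as [->|H1]; lra).
assert (E := one_minus_katsura_fukuda x Hx).
assert (Hd := katsura_fukuda_denominator x Hx).
destruct Hq as [Hq|Hq].
- assert (HF : katsura_fukuda l x < 1).
  { assert (H := Rsqr_pos_lt _
      (Rgt_not_eq _ _ (Rdiv_lt_0_compat _ _ Hq Hd))); lra. }
  rewrite !angle_inner by assumption.
  apply inner_angle_katsura_fukuda; [lra | exact Hq].
- assert (Hs : swap l x = x).
  { assert (H2 := swap_denominator x ltac:(lra)).
    apply (Rmult_eq_reg_r (1 - l * x)); [|lra].
    unfold swap; field_simplify; lra. }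
  assert (Ha := angle_swap x Hx); rewrite Hs in Ha.
  replace (katsura_fukuda l x) with 1; [rewrite angle_1; lra|].
  rewrite <- Hq in E; unfold Rdiv in E.
  rewrite Rmult_0_l, Rsqr_0 in E; lra.
Qed.
End Modulus.

(** * The rescaling of angles *)

Definition angle_rescaling (l l' x : R) : R :=
  epsilon (inhabits 0) (fun y => 0 <= y <= 1 /\
    angle l' y = complete_angle l' / complete_angle l * angle l x).

Section Conjugacy.
Variables l l' : R.
Hypotheses (hl : 0 <= l < 1) (hl' : 0 <= l' < 1).

Lemma angle_rescaling_spec (x : R) : 0 <= x <= 1 ->
  0 <= angle_rescaling l l' x <= 1 /\
  angle l' (angle_rescaling l l' x)
  = complete_angle l' / complete_angle l * angle l x.
Proof.
intros Hx; unfold angle_rescaling; apply epsilon_spec.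
apply angle_surjective; [exact hl'|].
assert (HK := complete_angle_pos l hl).
assert (HK' := complete_angle_pos l' hl').
assert (Ha := angle_bounds l hl x Hx).
assert (0 < complete_angle l' / complete_angle l)
  by (apply Rdiv_lt_0_compat; assumption).
split; [apply Rmult_le_pos; lra|].
replace (complete_angle l')
  with (complete_angle l' / complete_angle l * complete_angle l) at 2
  by (field; lra).
apply Rmult_le_compat_l; lra.
Qed.

Lemma angle_rescaling_range (x : R) :
  0 <= x <= 1 -> 0 <= angle_rescaling l l' x <= 1.
Proof. intros Hx; apply (angle_rescaling_spec x Hx). Qed.

Lemma angle_angle_rescaling (x : R) : 0 <= x <= 1 ->
  angle l' (angle_rescaling l l' x)
  = complete_angle l' / complete_angle l * angle l x.
Proof. intros Hx; apply (angle_rescaling_spec x Hx). Qed.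

Lemma angle_rescaling_swap (x : R) : 0 <= x <= 1 ->
  angle_rescaling l l' (swap l x) = swap l' (angle_rescaling l l' x).
Proof.
intros Hx.
assert (Hs := swap_range l hl x Hx).
assert (Hh := angle_rescaling_range x Hx).
apply (angle_injective l' hl').
- apply angle_rescaling_range, Hs.
- apply swap_range; assumption.
- rewrite (angle_swap l' hl') by exact Hh.
  rewrite !angle_angle_rescaling, (angle_swap l hl) by assumption.
  field; assert (HK := complete_angle_pos l hl); lra.
Qed.

Lemma angle_rescaling_monotone (x y : R) :
  0 <= x <= 1 -> 0 <= y <= 1 -> x <= y ->
  angle_rescaling l l' x <= angle_rescaling l l' y.
Proof.
intros Hx Hy Hxy.
apply (angle_le_inv l' hl'); [apply angle_rescaling_range, Hx
                             |apply angle_rescaling_range, Hy|].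
rewrite !angle_angle_rescaling by assumption.
assert (HK := complete_angle_pos l hl).
assert (HK' := complete_angle_pos l' hl').
apply Rmult_le_compat_l.
- apply Rdiv_le_0_compat; lra.
- destruct Hxy as [Hxy| ->]; [|lra].
  apply Rlt_le, (angle_increasing l hl); lra.
Qed.

(** On the lower half both sides have angle 2 (K'/K) u.  Upper points are
    moved to the lower half by [swap], which F does not see. *)
Lemma angle_rescaling_conjugates (x : R) : 0 <= x <= 1 ->
  angle_rescaling l l' (katsura_fukuda l x)
  = katsura_fukuda l' (angle_rescaling l l' x).
Proof.
assert (lower : forall x, 0 <= x <= 1 -> x <= swap l x ->
  angle_rescaling l l' (katsura_fukuda l x)
  = katsura_fukuda l' (angle_rescaling l l' x)).
{ clear x; intros x Hx Hlow.
  assert (Hs := swap_range l hl x Hx).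
  assert (Hh := angle_rescaling_range x Hx).
  assert (HF := katsura_fukuda_range l hl x Hx).
  apply (angle_injective l' hl').
  - apply angle_rescaling_range, HF.
  - apply katsura_fukuda_range; assumption.
  - rewrite (angle_katsura_fukuda l' hl').
    + rewrite !angle_angle_rescaling by assumption.
      rewrite (angle_katsura_fukuda l hl) by assumption; ring.
    + exact Hh.
    + rewrite <- angle_rescaling_swap by exact Hx.
      apply angle_rescaling_monotone; assumption. }
intros Hx; destruct (Rle_dec x (swap l x)) as [H|H]; [auto|].
assert (Hs := swap_range l hl x Hx).
assert (Hh := angle_rescaling_range x Hx).
assert (E := lower (swap l x) Hs).
rewrite (swap_involutive l hl) in E by lra.
rewrite katsura_fukuda_swap in E by assumption.
rewrite angle_rescaling_swap in E by exact Hx.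
rewrite katsura_fukuda_swap in E by assumption.
apply E; lra.
Qed.
End Conjugacy.

Lemma angle_rescaling_inverse (l l' x : R) :
  0 <= l < 1 -> 0 <= l' < 1 -> 0 <= x <= 1 ->
  angle_rescaling l' l (angle_rescaling l l' x) = x.
Proof.
intros hl hl' Hx.
assert (Hh := angle_rescaling_range l l' hl hl' x Hx).
apply (angle_injective l hl).
- apply angle_rescaling_range; assumption.
- exact Hx.
- rewrite !angle_angle_rescaling by assumption.
  field; split; apply Rgt_not_eq, complete_angle_pos; assumption.
Qed.

Lemma angle_rescaling_lt_1 (l l' x : R) :
  0 <= l < 1 -> 0 <= l' < 1 -> 0 <= x < 1 ->
  0 <= angle_rescaling l l' x < 1.
Proof.
intros hl hl' Hx.
destruct (angle_rescaling_range l l' hl hl' x ltac:(lra)) as [H0 [H1|H1]];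
  [lra|].
assert (E := angle_angle_rescaling l l' hl hl' x ltac:(lra)).
rewrite H1, angle_1 in E.
assert (HK := complete_angle_pos l hl).
assert (HK' := complete_angle_pos l' hl').
assert (Hlt := angle_increasing l hl x 1 ltac:(lra) ltac:(lra)).
rewrite angle_1 in Hlt.
apply (f_equal (Rmult (complete_angle l / complete_angle l'))) in E.
field_simplify in E; lra.
Qed.

Lemma square_angle_rescaling (l l' x : R) :
  0 <= l < 1 -> 0 <= l' < 1 -> 0 <= x < 1 ->
  square_angle l' (angle_rescaling l l' x)
  = (complete_angle l' / complete_angle l) ^ 2 * square_angle l x.
Proof.
intros hl hl' Hx.
assert (Hh := angle_rescaling_lt_1 l l' x hl hl' Hx).
assert (E := angle_angle_rescaling l l' hl hl' x ltac:(lra)).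
rewrite !angle_inner in E by lra; unfold inner_angle in E.
rewrite <- (pow2_sqrt (square_angle l' (angle_rescaling l l' x)))
  by (apply square_angle_nonneg; lra).
rewrite E, Rpow_mult_distr, pow2_sqrt by (apply square_angle_nonneg; lra).
reflexivity.
Qed.

(** The angles themselves are not smooth at 0, but their squares are, and
    they determine the rescaling implicitly. *)
Lemma smooth_on_angle_rescaling_off_1 (l l' : R) :
  0 <= l < 1 -> 0 <= l' < 1 ->
  smooth_on (fun x => 0 <= x < 1) (angle_rescaling l l').
Proof.
intros hl hl'.
set (c := (complete_angle l' / complete_angle l) ^ 2).
pose (dQ := fun l x => reduced_angle l x * density l x).
assert (DQ : forall l, 0 <= l < 1 -> forall x, 0 <= x < 1 ->
  D_in (square_angle l) (dQ l) (fun x => 0 <= x < 1) x).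
{ intros m hm x Hx; apply is_derive_D_in, is_derive_square_angle; [exact hm|].
  rewrite Rabs_pos_eq; lra. }
apply (smooth_on_implicit (fun x => 0 <= x < 1) (fun y => 0 <= y < 1)
  (angle_rescaling l l') (fun x => c * square_angle l x) (square_angle l')
  (fun x => c * dQ l x) (dQ l')).
- intros x; apply angle_rescaling_lt_1; assumption.
- intros x y Hx Hy E.
  rewrite <- (angle_rescaling_inverse l l' x), E by (assumption || lra).
  apply angle_rescaling_inverse; assumption || lra.
- intros x; apply square_angle_rescaling; assumption.
- intros y z; apply square_angle_expanding; assumption.
- intros x Hx; apply Dmult_const, DQ; assumption.
- apply DQ, hl'.
- apply smooth_on_mult; [apply smooth_on_const|].
  apply smooth_on_square_angle_derivative, hl.
- apply smooth_on_square_angle_derivative, hl'.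
- intros y Hy.
  assert (HG := reduced_angle_ge_1 l' hl' y Hy).
  assert (HR := density_ge_1 l' hl' y Hy).
  unfold dQ; apply Rmult_integral_contrapositive; split; lra.
Qed.

Lemma smooth_on_swap (l : R) :
  0 <= l < 1 -> smooth_on (fun x => 0 <= x <= 1) (swap l).
Proof.
intros hl.
assert (affine : forall a b, smooth_on (fun x => 0 <= x <= 1)
                               (fun x => a + b * x)).
{ intros a b; apply smooth_on_plus; [apply smooth_on_const|].
  apply smooth_on_mult; [apply smooth_on_const | apply smooth_on_id]. }
apply (smooth_on_ext _ (fun x => (1 + -1 * x) * / (1 + - l * x))).
- intros x _; unfold swap, Rdiv; f_equal; [ring | f_equal; ring].
- apply smooth_on_mult; [apply affine | apply smooth_on_inv; [|apply affine]].
  intros x Hx; assert (H := swap_denominator l hl x); lra.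
Qed.

(** The involutions exchange the endpoints and commute with the rescaling, so
    smoothness at 1 is smoothness at 0. *)
Lemma smooth_on_angle_rescaling (l l' : R) :
  0 <= l < 1 -> 0 <= l' < 1 ->
  smooth_on unit_interval (angle_rescaling l l').
Proof.
intros hl hl'; apply smooth_on_glue; [lra | |].
- apply smooth_on_angle_rescaling_off_1; assumption.
- apply (smooth_on_ext _
    (fun x => swap l' (angle_rescaling l l' (swap l x)))).
  { intros x Hx.
    assert (Hs := swap_range l hl x ltac:(lra)).
    rewrite <- (angle_rescaling_swap l l' hl hl') by exact Hs.
    rewrite (swap_involutive l hl) by lra; reflexivity. }
  assert (Hswap : maps_to (fun x => 0 < x <= 1) (fun x => 0 <= x < 1) (swap l)).
  { intros x Hx; split; [apply swap_range | apply swap_lt_1]; lra. }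
  apply (smooth_on_comp _ (fun y => 0 <= y <= 1)
           (fun x => angle_rescaling l l' (swap l x))).
  + intros x Hx; apply angle_rescaling_range; [exact hl | exact hl'|].
    assert (H := Hswap x Hx); lra.
  + apply (smooth_on_comp _ (fun y => 0 <= y < 1) (swap l)); [exact Hswap| |].
    * apply (smooth_on_subset _ (fun x => 0 <= x <= 1)); [intros; lra|].
      apply smooth_on_swap, hl.
    * apply smooth_on_angle_rescaling_off_1; assumption.
  + apply smooth_on_swap, hl'.
Qed.

Theorem theorem5p4 (l l' : R) (hl : 0 <= l < 1) (hl' : 0 <= l' < 1) :
  smoothly_conjugate unit_interval (katsura_fukuda l)
                     unit_interval (katsura_fukuda l').
Proof.
split; [intros x; apply katsura_fukuda_range, hl|].
split; [intros x; apply katsura_fukuda_range, hl'|].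
exists (angle_rescaling l l'); split.
- split; [intros x; apply angle_rescaling_range; assumption|].
  split; [apply smooth_on_angle_rescaling; assumption|].
  exists (angle_rescaling l' l).
  split; [intros x; apply angle_rescaling_range; assumption|].
  split; [apply smooth_on_angle_rescaling; assumption|].
  split; intros x Hx; apply angle_rescaling_inverse; assumption.
- intros x; apply angle_rescaling_conjugates; assumption.
Qed.
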